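(* Let $x,y\in\mathrm{Aper}(\sigma)$ and let $p\in[1,\infty]$. Then the following are equivalent: (1) $\pi_x^p$ and $\pi_y^p$ are algebraically equivalent; (2) $\pi_x^p$ and $\pi_y^p$ are topologically equivalent; (3) $\pi_x^p$ and $\pi_y^p$ are isometrically equivalent; (4) The orbits of $x$ and $y$ coincide.
   Context: $X$ is a non-empty compact Hausdorff space, $\sigma:X\to X$ is a homeomorphism, $\Sigma=(X,\sigma)$, and $\mathbb{Z}$ acts on $X$ via $n\mapsto\sigma^n$; orbits are orbits of this action. $\mathrm{Aper}(\sigma)$ is the set of aperiodic points (points with infinite orbit). $C(X)$ is the algebra of continuous complex-valued functions with the supremum norm, and $\alpha(f)=f\circ\sigma^{-1}$ for $f\in C(X)$. $\ell^1(\Sigma)$ is the Banach space of all $a:\mathbb{Z}\to C(X)$ with $\|a\|=\sum_n\|a(n)\|<\infty$, with multiplication $(aa')(n)=\sum_{k\in\mathbb{Z}}a(k)\,\alpha^k(a'(n-k))$; it is a unital Banach algebra. Elements are written $a=\sum_n f_n\delta^n$ with $f_n=a(n)\in C(X)$, where $\delta$ is the element with $\delta(1)=1$ and $\delta(m)=0$ for $m\neq1$. For $x\in\mathrm{Aper}(\sigma)$ and $p\in[1,\infty]$, $\pi_x^p$ is the unital contractive representation of $\ell^1(\Sigma)$ on $\ell^p(\mathbb{Z})$ (two-sided complex sequences) in which $f\in C(X)$ acts as multiplication of the $k$th coordinate by $f(\sigma^kx)$ for all $k\in\mathbb{Z}$, and $\delta$ acts as the right shift $S$, $(S\xi)(k)=\xi(k-1)$;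 i.e. $\pi_x^p(\sum_nf_n\delta^n)=\sum_n\pi_x^p(f_n)S^n$. Two representations on Banach spaces are algebraically (resp. topologically, isometrically) equivalent if there is an intertwining linear bijection (resp. linear homeomorphism, surjective linear isometry) between the representation spaces. *)

(* Defs.v *)
From HB Require Import structures.
From mathcomp Require Import all_boot all_order all_algebra.
From mathcomp Require Import all_classical all_reals all_analysis.
From mathcomp Require Import ess_sup_inf complex finmap.

Set Implicit Arguments.
Unset Strict Implicit.
Unset Printing Implicit Defensive.

Import Order.TTheory GRing.Theory Num.Theory.
Import numFieldNormedType.Exports.

Local Open Scope classical_set_scope.
Local Open Scope complex_scope.
Local Open Scope ring_scope.

Notation normc := Normc.normc.

(* a representation of A on V enters as its family of operators *)
Section equivalence.
Context {K : numFieldType} {A : Type} {V W : normedModType K}.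
Implicit Types (rho : A -> {linear V -> V}) (tau : A -> {linear W -> W}).

Definition intertwines rho tau (T : V -> W) :=
  forall a v, T (rho a v) = tau a (T v).

Definition algebraically_equivalent rho tau :=
  exists2 T : {linear V -> W}, bijective T & intertwines rho tau T.

Definition topologically_equivalent rho tau :=
  exists (T : {linear V -> W}) (T' : W -> V),
    [/\ cancel T T', cancel T' T, continuous T, continuous T' &
        intertwines rho tau T].

Definition isometrically_equivalent rho tau :=
  exists T : {linear V -> W},
    [/\ forall v, `|T v| = `|v|, forall w, exists v, T v = w &
        intertwines rho tau T].

End equivalence.

Record homeo (X : topologicalType) := Homeo {
  homeo_fun :> X -> X;
  homeo_inv : X -> X;
  homeo_funK : cancel homeo_fun homeo_inv;
  homeo_invK : cancel homeo_inv homeo_fun;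
  homeo_fun_continuous : continuous homeo_fun;
  homeo_inv_continuous : continuous homeo_inv }.

Section dynamics.
Context {X : topologicalType} (sigma : homeo X).

(* [Negz n] is the integer -(n+1) *)
Definition homeo_exp (k : int) (x : X) : X :=
  match k with
  | Posz n => iter n sigma x
  | Negz n => iter n.+1 (homeo_inv sigma) x
  end.

Definition zorbit (x : X) : set X := [set homeo_exp k x | k in [set: int]].

Definition Aper : set X := [set x | infinite_set (zorbit x)].

End dynamics.

HB.instance Definition _ := isPointed.Build int 0.
HB.instance Definition _ := @isMeasurable.Build default_measure_display
  int discrete_measurable discrete_measurable0
  discrete_measurableC discrete_measurableU.

Section two_sided_series.
Context {R : realType}.

(* the sum over Z; only used for absolutely convergent families *)
Definition zsum (u : int -> R[i]) : R[i] :=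
  limn (series (fun n => u (Posz n)) : nat -> R[i]^o) +
  limn (series (fun n => u (Negz n)) : nat -> R[i]^o).

Lemma normr_normc (z : R[i]) : `|z| = (normc z)%:C.
Proof. by []. Qed.

Lemma normc_ge0 (z : R[i]) : 0 <= normc z.
Proof. by rewrite -ler0c -normr_normc. Qed.

Lemma cvg_series_normc (u : nat -> R[i]) (c : R) :
  (forall N, \sum_(0 <= n < N) normc (u n) <= c) ->
  cvgn (series u : nat -> R[i]^o).
Proof.
move=> uc.
have cv (f : nat -> R) : (forall n, `|f n| <= normc (u n)) -> cvgn (series f).
  move=> fu; apply: normed_cvg.
  suff : cvgn (series (fun n => `|f n|)) by [].
  apply: nondecreasing_is_cvgn.
    by apply/nondecreasing_seqP => n; rewrite seriesSr lerDl.
  exists c => _ [N _ <-]; apply: le_trans (uc N).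
  by rewrite /series/=; apply: ler_sum => n _.
have cRe : cvgn (series (fun n => complex.Re (u n))).
  by apply: cv => n; rewrite -lecR -normr_normc normc_ge_Re.
have cIm : cvgn (series (fun n => complex.Im (u n))).
  apply: cv => n; rewrite -lecR -normr_normc.
  have := normc_ge_Re (u n * 'i); rewrite ReiNIm normrN normrM.
  by rewrite [X in _ * X](_ : _ = 1) ?mulr1// normr_normc /normc/= expr0n/= add0r
    expr1n sqrtr1.
pose a := limn (series (fun n => complex.Re (u n))).
pose b := limn (series (fun n => complex.Im (u n))).
have sE N : series u N = (series (fun n => complex.Re (u n)) N)%:C +
    'i * (series (fun n => complex.Im (u n)) N)%:C.
  rewrite /series/= !rmorph_sum/= mulr_sumr -big_split/=.
  by apply: eq_bigr => n _; exact: complexE.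
apply/cvg_ex; exists (a%:C + 'i * b%:C : R[i]^o).
apply/cvgrPdist_lt => e e0.
have eE : e = (complex.Re e)%:C by rewrite RRe_real// gtr0_real.
have e20 : 0 < complex.Re e / 2.
  by rewrite divr_gt0// -ltcR -eE.
near=> N.
rewrite sE opprD addrACA -mulrBr -!rmorphB/=.
apply: (@le_lt_trans _ _
  (`|(a - series (fun n => complex.Re (u n)) N)%:C| +
   `|'i * (b - series (fun n => complex.Im (u n)) N)%:C|)).
  exact: ler_normD.
rewrite normrM [X in _ + X * _](_ : _ = 1); last first.
  by rewrite normr_normc /normc/= expr0n/= add0r expr1n sqrtr1.
rewrite mul1r !normc_def/= expr0n/= !addr0 !sqrtr_sqr -rmorphD/= eE ltcR.
rewrite [ltRHS](splitr (complex.Re e)) ltrD//; near: N.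
- by move/cvgrPdist_lt: cRe; exact.
- by move/cvgrPdist_lt: cIm; exact.
Unshelve. all: by end_near. Qed.

Definition zbounded (u : int -> R[i]) (c : R) := forall N,
  \sum_(0 <= n < N) (normc (u (Posz n)) + normc (u (Negz n))) <= c.

Lemma zbounded_cvg u c : zbounded u c ->
  cvgn (series (fun n => u (Posz n)) : nat -> R[i]^o) /\
  cvgn (series (fun n => u (Negz n)) : nat -> R[i]^o).
Proof.
move=> uc; split; apply: (@cvg_series_normc _ c) => N;
  apply: le_trans (uc N); apply: ler_sum => n _; rewrite ?lerDl ?lerDr normc_ge0//.
Qed.

Lemma limn_series_linear (K : numFieldType) (f g : nat -> K^o) (a : K) :
  cvgn (series f) -> cvgn (series g) ->
  limn (series (fun n => a *: f n + g n)) = a *: limn (series f) + limn (series g).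
Proof.
move=> cf cg; apply/cvg_lim => //.
rewrite (_ : series _ = (a \*: series f) \+ series g); last first.
  by apply/funext => N; rewrite /series/= big_split/= -scaler_sumr.
by apply: cvgD => //; apply: cvgZr.
Qed.

Lemma limn_series_single (K : numFieldType) (f : nat -> K^o) (m : nat) :
  (forall n, n != m -> f n = 0) -> limn (series f) = f m.
Proof.
move=> f0; apply: lim_near_cst => //; near=> N.
have mN : (m < N)%N by near: N; exact: nbhs_infty_gt.
rewrite /series/= big_mkord (bigD1 (Ordinal mN))//= big1 ?addr0// => i im.
by apply: f0; apply: contra im => /eqP im; apply/eqP/val_inj.
Unshelve. all: by end_near. Qed.

Lemma zsum_single u (m : int) : (forall n, n != m -> u n = 0) -> zsum u = u m.
Proof.
move=> u0; rewrite /zsum; case: m u0 => m u0.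
- rewrite (limn_series_single (m := m) (f := (fun n => u (Posz n)) : nat -> R[i]^o)).
    rewrite (limn_series_single (m := 0) (f := (fun n => u (Negz n)) : nat -> R[i]^o)).
      by rewrite (u0 (Negz 0))// addr0.
    by move=> n _; exact: u0.
  by move=> n nm; exact: u0.
- rewrite (limn_series_single (m := 0) (f := (fun n => u (Posz n)) : nat -> R[i]^o)).
    rewrite (limn_series_single (m := m) (f := (fun n => u (Negz n)) : nat -> R[i]^o)).
      by rewrite (u0 (Posz 0))// add0r.
    by move=> n nm; exact: u0.
  by move=> n _; exact: u0.
Qed.

Lemma zsum_linear u v (a : R[i]) c d : zbounded u c -> zbounded v d ->
  zsum (fun n => a * u n + v n) = a * zsum u + zsum v.
Proof.
move=> /zbounded_cvg[u1 u2] /zbounded_cvg[v1 v2].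
rewrite mulrDr addrACA; congr (_ + _).
- exact: (limn_series_linear a u1 v1).
- exact: (limn_series_linear a u2 v2).
Qed.

Lemma zsum_le u c : zbounded u c -> normc (zsum u) <= c.
Proof.
move=> uc; have [u1 u2] := zbounded_cvg uc; rewrite /zsum.
move: (limn _) u1 (limn _) u2 => l1 u1 l2 u2.
apply/ler_addgt0Pr => e e0; rewrite -lecR -normr_normc.
have e20 : 0 < (e / 2)%:C by rewrite ltcR divr_gt0.
near \oo => N.
have -> : l1 + l2 = (l1 - series (fun n => u (Posz n)) N) +
    (l2 - series (fun n => u (Negz n)) N) +
    (series (fun n => u (Posz n)) N + series (fun n => u (Negz n)) N).
  by rewrite addrACA !subrK.
apply: le_trans (ler_normD _ _) _; rewrite addrC rmorphD/=; apply: lerD.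
  rewrite /series/= -big_split/=; apply: le_trans (ler_norm_sum _ _ _) _.
  apply: (@le_trans _ _ (\sum_(0 <= n < N) (normc (u (Posz n)) + normc (u (Negz n))))%:C).
    rewrite rmorph_sum/=; apply: ler_sum => n _.
    by rewrite rmorphD/= -!normr_normc ler_normD.
  by rewrite lecR uc.
apply: le_trans (ler_normD _ _) _; rewrite [e in leRHS]splitr rmorphD/=.
apply: lerD; apply: ltW; near: N.
- by move/cvgrPdist_lt : u1; exact.
- by move/cvgrPdist_lt : u2; exact.
Unshelve. all: by end_near. Qed.

Lemma eq_zsum u v : u =1 v -> zsum u = zsum v.
Proof. by move=> /funext ->. Qed.

End two_sided_series.
Section counting_Lnorm.
Context {R : realType}.
Local Open Scope ereal_scope.
Local Notation mu := (@counting int R).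
Implicit Types (p : \bar R) (f g : int -> R).

Lemma measurable_fun_int d (T : measurableType d) (D : set int) (f : int -> T) :
  measurable_fun D f.
Proof. by move=> _ Y _. Qed.

Let itvy (x : \bar R) : 0 <= x -> x \in `[0, +oo].
Proof. by move=> x0; rewrite in_itv/= x0 leey. Qed.

Lemma le_counting (A B : set int) : A `<=` B -> mu A <= mu B.
Proof. by move=> AB; apply: le_measure => //; apply/mem_set. Qed.

Lemma counting_set1 (k : int) : mu [set k] = 1.
Proof. by rewrite /counting asboolT// fset_set1 cardfs1. Qed.

Lemma counting_ae (P : set int) : (\forall k \ae mu, P k) -> forall k, P k.
Proof.
move=> [N [_ N0 PN]] k; apply: contrapT => Pk.
have : mu [set k] <= mu N.
  by apply: le_counting => _ ->; exact: PN.
by rewrite N0 counting_set1 leNgt lte01.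
Qed.

Lemma counting_gt0 : 0 < mu [set: int].
Proof.
apply: (@lt_le_trans _ _ (mu [set 0%R])); first by rewrite counting_set1.
exact: le_counting.
Qed.

Lemma Lnorm_counting_ge p f k : 1 <= p -> `|f k|%:E <= 'N[mu]_p[EFin \o f].
Proof.
move=> p1; rewrite unlock; case: p p1 => [r| |//] r1; last first.
  rewrite counting_gt0; exact: (counting_ae (ess_sup_ge mu (abse \o (EFin \o f)))).
have r0 : (0 < r)%R by rewrite (lt_le_trans ltr01).
rewrite -[leLHS]poweRe1// -{1}(mulfV (lt0r_neq0 r0)) poweRrM.
have h0 (x : int) : 0 <= `|(EFin \o f) x| `^ r by exact: poweR_ge0.
apply: gt0_ler_poweR; rewrite ?invr_ge0 ?(ltW r0)//.
- exact/itvy/poweR_ge0.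
- by apply: itvy; apply: integral_ge0.
apply: (@le_trans _ _ (\int[mu]_(x in [set k]) (`|(EFin \o f) x| `^ r))).
  rewrite (eq_integral (cst (`|f k|%:E `^ r))); last by move=> x /set_mem ->.
  by rewrite integral_cst//= counting_set1 mule1.
by apply: ge0_subset_integral => //; exact: measurable_fun_int.
Qed.

Lemma le_Lnorm_counting p f g : 1 <= p -> (forall k, `|f k| <= `|g k|)%R ->
  'N[mu]_p[EFin \o f] <= 'N[mu]_p[EFin \o g].
Proof.
move=> p1 fg; rewrite unlock; case: p p1 => [r| |//] r1; last first.
  by rewrite counting_gt0; apply/le_ess_sup/nearW => k/=; rewrite lee_fin.
have r0 : (0 < r)%R by rewrite (lt_le_trans ltr01).
apply: gt0_ler_poweR; rewrite ?invr_ge0 ?(ltW r0)//.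
- by apply: itvy; apply: integral_ge0 => x _; exact: poweR_ge0.
- by apply: itvy; apply: integral_ge0 => x _; exact: poweR_ge0.
apply: ge0_le_integral => //; do ?by move=> x _; exact: poweR_ge0.
by move=> k _ /=; rewrite lee_fin ge0_ler_powR ?nnegrE// ltW.
Qed.

Lemma Lnorm_counting_sup p (g : nat -> int -> R) (h : int -> R) (C : \bar R) :
  1 <= p -> (forall n k, 0 <= g n k)%R -> (forall k, 0 <= h k)%R ->
  (forall k, nondecreasing_seq (g ^~ k)) ->
  (forall k c, (forall n, g n k <= c) -> h k <= c)%R ->
  (forall n, 'N[mu]_p[EFin \o g n] <= C) -> 'N[mu]_p[EFin \o h] <= C.
Proof.
move=> p1 g0 h0 ndg gh gC.
have C0 : 0 <= C by apply: le_trans (gC 0%N); exact: Lnorm_ge0.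
case: C C0 gC => [c| |//] C0 gC; last by rewrite leey.
case: p p1 gC => [r| |//] r1 gC; last first.
  rewrite unlock counting_gt0; apply/ess_supP/nearW => k /=.
  rewrite lee_fin ger0_norm//; apply: gh => n.
  rewrite -(ger0_norm (g0 n k)) -lee_fin (le_trans _ (gC n))//.
  exact: Lnorm_counting_ge.
have r0 : (0 < r)%R by rewrite (lt_le_trans ltr01).
have rN0 : r != 0%R by rewrite gt_eqF.
have hi (f : int -> R) : 0 <= \int[mu]_k (`|f k| `^ r)%:E.
  by apply: integral_ge0 => k _; rewrite lee_fin powR_ge0.
have powN (f : int -> R) :
    'N[mu]_r%:E[EFin \o f] `^ r = \int[mu]_k (`|f k| `^ r)%:E.
  by rewrite poweR_Lnorm.
have key : \int[mu]_k (`|h k| `^ r)%:E <= c%:E `^ r.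
  have cg : \int[mu]_k limn (fun n => (`|g n k| `^ r)%:E) =
      limn (fun n => \int[mu]_k (`|g n k| `^ r)%:E).
    apply: monotone_convergence => //.
    - move=> k _ m n mn; rewrite lee_fin ge0_ler_powR ?nnegrE ?(ltW r0)//.
      by rewrite !ger0_norm//; exact: ndg.
  have nd k : nondecreasing_seq (fun n => (`|g n k| `^ r)%:E).
    move=> m n mn; rewrite lee_fin ge0_ler_powR ?nnegrE ?(ltW r0)//.
    by rewrite !ger0_norm//; exact: ndg.
  apply: (@le_trans _ _ (\int[mu]_k limn (fun n => (`|g n k| `^ r)%:E))).
    apply: ge0_le_integral => //.
    - move=> k _; rewrite (cvg_lim _ (ereal_nondecreasing_cvgn (nd k)))//.
      have ub n : (`|g n k| `^ r)%:E <= ereal_sup (range (fun n => (`|g n k| `^ r)%:E)).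
        by apply: ereal_sup_ubound; exists n.
      case: ereal_sup ub => [l| |] ub; last 2 first.
      + by rewrite leey.
      + by have := ub 0%N.
      have l0 : (0 <= l)%R.
        by rewrite -lee_fin (le_trans _ (ub 0%N))// lee_fin powR_ge0.
      rewrite lee_fin -(powRr1 l0) -(mulVf rN0) powRrM ge0_ler_powR ?nnegrE ?powR_ge0 ?(ltW r0)//.
      rewrite ger0_norm//; apply: gh => n.
      rewrite -(ger0_norm (g0 n k)) -(powRr1 (normr_ge0 _)) -(mulfV rN0) powRrM.
      by rewrite ge0_ler_powR ?nnegrE ?powR_ge0 ?invr_ge0 ?(ltW r0)// -lee_fin.
  rewrite cg; apply: lime_le.
    apply: ereal_nondecreasing_is_cvgn => m n mn.
    by apply: ge0_le_integral => // k _; exact: nd.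
  apply: nearW => n; rewrite -powN.
  apply: gt0_ler_poweR => //; first exact: ltW.
  + exact/itvy/Lnorm_ge0.
  + exact: itvy.
rewrite -(poweRe1 (Lnorm_ge0 _ _ _)) -(mulfV rN0) poweRrM powN.
rewrite -[leRHS]poweRe1// -(mulfV rN0) poweRrM.
apply: gt0_ler_poweR => //; rewrite ?invr_ge0 ?(ltW r0)//.
- exact: itvy.
- exact/itvy/poweR_ge0.
Qed.

Lemma counting_shift (A : set int) (m : int) :
  @counting int R ((fun k => k + m)%R @^-1` A) = counting A.
Proof.
have phiE : (fun k : int => (k + m)%R) @^-1` A = (fun k => (k - m)%R) @` A.
  apply/seteqP; split => k /=.
    by move=> Ak; exists (k + m)%R; rewrite ?addrK.
  by move=> [j Aj <-]; rewrite subrK.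
have injm : injective (fun k : int => (k - m)%R) by move=> a b /addIr.
rewrite /counting phiE; have [fA|fA] := pselect (finite_set A); last first.
  rewrite !asboolF// => fmA; apply: fA.
  rewrite (_ : A = (fun k => (k + m)%R) @` ((fun k => (k - m)%R) @` A)).
    exact: finite_image.
  by rewrite image_comp (_ : _ \o _ = id) ?image_id//; apply/funext => k /=; rewrite subrK.
rewrite !asboolT//; last exact: finite_image.
by rewrite fset_set_image// card_imfset.
Qed.

Lemma Lnorm_counting_shift p f (m : int) : 1 <= p ->
  'N[mu]_p[EFin \o (fun k => f (k + m)%R)] = 'N[mu]_p[EFin \o f].
Proof.
move=> p1; apply/eqP; rewrite eq_le; apply/andP.
wlog suff : f m / 'N[mu]_p[EFin \o (fun k => f (k + m)%R)] <= 'N[mu]_p[EFin \o f].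
  move=> H; split; first exact: H.
  apply: le_trans (H (fun k => f (k + m)%R) (- m)%R).
  by rewrite [X in _ <= 'N[mu]_p[X]](_ : _ = EFin \o f)//; apply/funext => k /=; rewrite subrK.
rewrite unlock; case: p p1 => [r| |//] r1; last first.
  rewrite counting_gt0; apply/ess_supP/nearW => k /=.
  exact: (counting_ae (ess_sup_ge mu (abse \o (EFin \o f)))).
rewrite le_eqVlt; apply/orP; left; apply/eqP; congr (_ `^ _).
have mphi : measurable_fun [set: int] (fun k : int => (k + m)%R).
  exact: measurable_fun_int.
transitivity (\int[pushforward mu (fun k : int => (k + m)%R)]_k (`|(EFin \o f) k| `^ r)).
  by rewrite ge0_integral_pushforward// => k _; exact: poweR_ge0.
apply: eq_measure_integral => A _ _; exact: counting_shift.
Qed.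
End counting_Lnorm.

Section lp_space.
Context {R : realType}.
Local Open Scope ereal_scope.
Implicit Types (p : \bar R) (xi zeta : int -> R[i]).

Definition lpnorm p xi : \bar R :=
  'N[@counting int R]_p[EFin \o (fun k => normc (xi k))].

Lemma lpnorm_ge0 p xi : 0 <= lpnorm p xi.
Proof. exact: Lnorm_ge0. Qed.

Lemma lpnorm0 p : 1 <= p -> lpnorm p (0 : int -> R[i])%R = 0.
Proof.
move=> p1; rewrite /lpnorm (_ : _ \o _ = cst 0).
  by rewrite Lnorm0// gt_eqF// (lt_le_trans _ p1).
by apply/funext => k; congr EFin; exact: Normc.normc0.
Qed.

Lemma lpnormD p xi zeta : 1 <= p ->
  lpnorm p (xi + zeta)%R <= lpnorm p xi + lpnorm p zeta.
Proof.
move=> p1; apply: le_trans.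
  apply: (@le_Lnorm_counting _ p _ (fun k => normc (xi k) + normc (zeta k))%R) => // k.
  rewrite !ger0_norm ?addr_ge0 ?normc_ge0//.
  by rewrite -lecR rmorphD/= -!normr_normc ler_normD.
by apply: eminkowski.
Qed.

Lemma Lnorm_countingZ p (f : int -> R) (a : R) : 1 <= p -> (0 <= a)%R ->
  'N[@counting int R]_p[EFin \o f] < +oo ->
  'N[@counting int R]_p[EFin \o (fun k => a * f k)%R] =
  a%:E * 'N[@counting int R]_p[EFin \o f].
Proof.
move=> p1 a0 fy.
have fL : f \in Lfun (@counting int R) p.
  by rewrite inE; apply/andP; split; apply/mem_set.
have := LnormZ (Lfun_Sub p1 fL) a.
by rewrite ger0_norm.
Qed.

Lemma lpnormZ p (a : R[i]) xi : 1 <= p -> lpnorm p xi < +oo ->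
  lpnorm p (a *: xi)%R = (normc a)%:E * lpnorm p xi.
Proof.
move=> p1 xiy; rewrite -Lnorm_countingZ ?normc_ge0//.
by apply: eq_Lnorm => k /=; rewrite -Normc.normcM.
Qed.

Lemma normc_le_lpnorm p xi k : 1 <= p -> (normc (xi k))%:E <= lpnorm p xi.
Proof.
move=> p1; rewrite -[normc _]ger0_norm ?normc_ge0//.
exact: (@Lnorm_counting_ge _ p (fun k => normc (xi k))).
Qed.

Lemma lp_submod_closed p : 1 <= p ->
  submod_closed [pred xi : int -> R[i] | lpnorm p xi < +oo].
Proof.
move=> p1; split; first by rewrite inE lpnorm0.
move=> a xi zeta; rewrite !inE => xiy zetay.
rewrite (le_lt_trans (lpnormD _ _ p1))// lte_add_pinfty// lpnormZ//.
by rewrite lte_mul_pinfty// lee_fin normc_ge0.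
Qed.

(* the otherwise unused [p1] lets the instances below be inferred *)
Record lp p (p1 : 1 <= p) :=
  Lp { lp_fun :> int -> R[i]; lp_finite : lpnorm p lp_fun < +oo }.

Section lp_instances.
Variables (p : \bar R) (p1 : 1 <= p).

HB.instance Definition _ := [isSub for @lp_fun p p1].
HB.instance Definition _ := [Choice of lp p1 by <:].
HB.instance Definition _ :=
  GRing.SubChoice_isSubLmodule.Build R[i] (int -> R[i]) _ (lp p1)
    (lp_submod_closed p1).

Definition lp_norm (xi : lp p1) : R[i] := (fine (lpnorm p xi))%:C%C.

Lemma lp_normE (xi : lp p1) : (complex.Re (lp_norm xi))%:E = lpnorm p xi.
Proof. by rewrite /= fineK// ge0_fin_numE ?lpnorm_ge0 ?lp_finite. Qed.

Lemma lp_normD (xi zeta : lp p1) :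
  (lp_norm (xi + zeta) <= lp_norm xi + lp_norm zeta)%R.
Proof. by rewrite -rmorphD/= lecR -lee_fin EFinD !lp_normE lpnormD. Qed.

Lemma lp_normZ (a : R[i]) (xi : lp p1) :
  (lp_norm (a *: xi) = `|a| * lp_norm xi)%R.
Proof.
rewrite normr_normc -rmorphM/=; congr (_%:C)%C; apply/EFin_inj.
by rewrite EFinM !lp_normE lpnormZ// lp_finite.
Qed.

Lemma lp_norm_eq0 (xi : lp p1) : lp_norm xi = 0%R -> xi = 0%R.
Proof.
move=> h; have xi0 : lpnorm p xi = 0 by rewrite -lp_normE h.
apply/val_inj/funext => k /=; apply: Normc.eq0_normc; apply/eqP.
rewrite eq_le normc_ge0 andbT -lee_fin.
by apply: le_trans (normc_le_lpnorm xi k p1) _; rewrite xi0.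
Qed.

HB.instance Definition _ :=
  Lmodule_isNormed.Build R[i] (lp p1) lp_normD lp_normZ lp_norm_eq0.

End lp_instances.
End lp_space.

Section crossed_product.
Context {R : realType} {X : topologicalType}.
Local Open Scope ereal_scope.

Definition supnorm (f : X -> R[i]) : \bar R :=
  ereal_sup [set (normc (f x))%:E | x in [set: X]].

(* [a n] is the coefficient f_n of delta^n; the underlying Banach space of
   l^1(Sigma) does not depend on the homeomorphism *)
Record l1Sigma := L1Sigma {
  l1_coef :> int -> X -> R[i];
  l1_continuous : forall n, continuous (l1_coef n : X -> R[i]^o);
  l1_summable : \esum_(n in [set: int]) supnorm (l1_coef n) < +oo }.

Definition l1_norm (a : l1Sigma) : \bar R :=
  \esum_(n in [set: int]) supnorm (a n).

End crossed_product.
Arguments l1Sigma : clear implicits.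

Section pi_rep.
Context {R : realType} {X : topologicalType} (sigma : homeo X) (x : X).
Local Open Scope ereal_scope.
Implicit Types (a : l1Sigma R X) (xi : int -> R[i]).

(* the k-th coordinate of sum_n pi(f_n) S^n xi *)
Definition pi_fun a xi : int -> R[i] :=
  fun k => zsum (fun n => a n (homeo_exp sigma k x) * xi (k - n))%R.

Let M a n : R := fine (supnorm (a n)).
Let A a : R := fine (l1_norm a).

Let supnorm_ge0 (f : X -> R[i]) : 0 <= supnorm f.
Proof.
apply: (@le_trans _ _ (normc (f x))%:E); first by rewrite lee_fin normc_ge0.
by apply: ereal_sup_ubound; exists x.
Qed.

Let l1_norm_ge0 a : 0 <= l1_norm a.
Proof. by apply: esum_ge0 => n _; exact: supnorm_ge0. Qed.

Let AE a : (A a)%:E = l1_norm a.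
Proof. by rewrite fineK// ge0_fin_numE ?l1_norm_ge0// l1_summable. Qed.

Let ME a n : (M a n)%:E = supnorm (a n).
Proof.
rewrite fineK// ge0_fin_numE ?supnorm_ge0//.
apply: le_lt_trans (l1_summable a); apply: esum_ge; exists [set n].
  by split => //; exact: finite_set1.
by rewrite fsbig_set1.
Qed.

Let M_ge0 a n : (0 <= M a n)%R.
Proof. by rewrite -lee_fin ME supnorm_ge0. Qed.

Let coef_le a n y : (normc (a n y) <= M a n)%R.
Proof. by rewrite -lee_fin ME; apply: ereal_sup_ubound; exists y. Qed.

Let sumM_le a N :
  (\sum_(0 <= n < N) (M a (Posz n) + M a (Negz n)) <= A a)%R.
Proof.
rewrite -lee_fin AE; apply: esum_ge.
pose s := [seq Posz n | n <- iota 0 N] ++ [seq Negz n | n <- iota 0 N].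
have us : uniq s.
  rewrite cat_uniq !map_inj_uniq ?iota_uniq ?andbT//=; last 2 first.
    by move=> ? ? [].
    by move=> ? ? [].
  by apply/hasPn => _ /mapP[n _ ->]; apply/mapP => -[].
exists [set` s]; first by split => //; exact: finite_seq.
rewrite -(fsbig_seq _ _ us) big_cat/= !big_map big_split/= EFinD.
rewrite /index_iota subn0 -!sumEFin leeD//.
  by apply: lee_sum => n _; rewrite ME.
by apply: lee_sum => n _; rewrite ME.
Qed.

Let g a xi N k : R := (\sum_(0 <= n < N)
  (M a (Posz n) * normc (xi (k - Posz n)) + M a (Negz n) * normc (xi (k - Negz n))))%R.

Let pi_fun_zbounded a xi k c : (forall N, g a xi N k <= c)%R ->
  zbounded (fun n => a n (homeo_exp sigma k x) * xi (k - n))%R c.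
Proof.
move=> gc N; apply: le_trans (gc N); apply: ler_sum => n _.
by rewrite !Normc.normcM; apply: lerD; apply: ler_wpM2r; rewrite ?normc_ge0.
Qed.

Let gE a xi N (L := fun m => (fun k => M a m * normc (xi (k - m)))%R) :
  g a xi N.+1 = (fun k => g a xi N k + (L (Posz N) k + L (Negz N) k))%R.
Proof. by apply/funext => k; rewrite /g big_nat_recr. Qed.

Let g_ge0 a xi N k : (0 <= g a xi N k)%R.
Proof. by apply: sumr_ge0 => n _; rewrite addr_ge0 ?mulr_ge0 ?normc_ge0. Qed.

Let g_le p a xi N : 1 <= p -> lpnorm p xi < +oo ->
  'N[@counting int R]_p[EFin \o g a xi N] <= l1_norm a * lpnorm p xi.
Proof.
move=> p1 xiy.
have LE m : 'N[@counting int R]_p[EFin \o (fun k => M a m * normc (xi (k - m)))%R]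
    = (M a m)%:E * lpnorm p xi.
  have sh := @Lnorm_counting_shift R p (fun k => normc (xi k)) (- m)%R p1.
  by rewrite (@Lnorm_countingZ _ p (fun k => normc (xi (k - m)%R)))// sh.
apply: (@le_trans _ _
  ((\sum_(0 <= n < N) (M a (Posz n) + M a (Negz n)))%:E * lpnorm p xi)); last first.
  by rewrite lee_wpmul2r ?lpnorm_ge0// -AE lee_fin sumM_le.
elim: N => [|N IH].
  rewrite (_ : g a xi 0 = (fun k => 0 * g a xi 0 k)%R); last first.
    by apply/funext => k; rewrite /g big_geq// mul0r.
  rewrite /g; under eq_Lnorm do rewrite /= mul0r.
  by rewrite Lnorm0 ?big_geq ?mul0e// gt_eqF// (lt_le_trans _ p1).
rewrite gE big_nat_recr//= EFinD ge0_muleDl; last 2 first.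
  by rewrite lee_fin sumr_ge0// => n _; rewrite addr_ge0.
  by rewrite lee_fin addr_ge0.
have mf (f : int -> R) : measurable_fun [set: int] f by exact: measurable_fun_int.
apply: le_trans (eminkowski _ (mf _) (mf _) p1) _; apply: leeD => //.
rewrite EFinD ge0_muleDl ?lee_fin// -!LE.
exact: (eminkowski _ (mf _) (mf _) p1).
Qed.

Lemma lpnorm_pi_fun p a xi : 1 <= p -> lpnorm p xi < +oo ->
  lpnorm p (pi_fun a xi) <= l1_norm a * lpnorm p xi.
Proof.
move=> p1 xiy; apply: (@Lnorm_counting_sup _ p (g a xi)) => //.
- by move=> k; rewrite normc_ge0.
- move=> k; apply/nondecreasing_seqP => N; rewrite gE lerDl.
  by rewrite addr_ge0 ?mulr_ge0 ?normc_ge0.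
- by move=> k c gc; apply: zsum_le; exact: pi_fun_zbounded.
- by move=> N; exact: g_le.
Qed.

Lemma pi_fun_summable p a xi k : 1 <= p -> lpnorm p xi < +oo ->
  exists c, zbounded (fun n => a n (homeo_exp sigma k x) * xi (k - n))%R c.
Proof.
move=> p1 xiy; exists (fine (l1_norm a * lpnorm p xi)).
apply: pi_fun_zbounded => N; rewrite -lee_fin fineK; last first.
  rewrite ge0_fin_numE ?mule_ge0 ?lpnorm_ge0// lte_mul_pinfty//.
  by rewrite -AE.
apply: le_trans (g_le a N p1 xiy); rewrite -(ger0_norm (g_ge0 a xi N k)).
exact: Lnorm_counting_ge.
Qed.

Variables (p : \bar R) (p1 : 1 <= p).

Lemma pi_fun_lp a (xi : lp p1) : lpnorm p (pi_fun a xi) < +oo.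
Proof.
apply: le_lt_trans (lpnorm_pi_fun a p1 (lp_finite xi)) _.
by rewrite -AE lte_mul_pinfty ?lee_fin ?fine_ge0 ?lp_finite.
Qed.

Definition pi_op a (xi : lp p1) : lp p1 := Lp p1 (pi_fun_lp a xi).

Lemma pi_op_linear a : linear (pi_op a).
Proof.
move=> c xi zeta; apply/val_inj/funext => k /=.
have [d1 h1] := pi_fun_summable a k p1 (lp_finite xi).
have [d2 h2] := pi_fun_summable a k p1 (lp_finite zeta).
rewrite [RHS](_ : _ = c * pi_fun a xi k + pi_fun a zeta k)%R//.
rewrite -(zsum_linear c h1 h2); apply: eq_zsum => n.
rewrite [X in (_ * X)%R](_ : _ = c * xi (k - n) + zeta (k - n))%R//.
by rewrite mulrDr mulrCA.
Qed.

HB.instance Definition _ a :=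
  GRing.isLinear.Build R[i] (lp p1) (lp p1) _ (pi_op a) (pi_op_linear a).

Definition pi_rep a : {linear lp p1 -> lp p1} := pi_op a.

Lemma pi_repE a (xi : lp p1) k :
  pi_rep a xi k = zsum (fun n => a n (homeo_exp sigma k x) * xi (k - n))%R.
Proof. by []. Qed.

(* pi(f delta^m) = pi(f) S^m; in particular f acts as multiplication by
   f(sigma^k x) and delta as the right shift *)
Lemma pi_rep_monomial a (m : int) (xi : lp p1) k :
  (forall n y, n != m -> a n y = 0%R) ->
  pi_rep a xi k = (a m (homeo_exp sigma k x) * xi (k - m))%R.
Proof.
move=> a0; rewrite pi_repE (zsum_single (m := m))// => n nm.
by rewrite a0// mul0r.
Qed.

Lemma pi_rep_contractive a (xi : lp p1) :
  (`|pi_rep a xi| <= (fine (l1_norm a))%:C%C * `|xi|)%R.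
Proof.
have nE (z : lp p1) : `|z|%R = lp_norm z by [].
rewrite !nE -rmorphM/= lecR.
rewrite -lee_fin EFinM !lp_normE AE.
exact: lpnorm_pi_fun (lp_finite xi).
Qed.

End pi_rep.

(* Main.v *)
Require Import Defs.
From HB Require Import structures.
From mathcomp Require Import all_boot all_order all_algebra.
From mathcomp Require Import all_classical all_reals all_analysis.
From mathcomp Require Import ess_sup_inf complex.

Import Order.TTheory GRing.Theory Num.Theory.
Import numFieldNormedType.Exports.

Local Open Scope classical_set_scope.
Local Open Scope ring_scope.

(** The representation space carries the data of the base point: the basis
vector [e_0] is a joint eigenvector of [C(X)] in [pi_x] with eigenvalue
[f |-> f x], so an injective intertwiner sends it to a nonzero sequence [eta]
with [f (sigma^k y) * eta k = f x * eta k] for all [f] and [k].  Wherever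
[eta k != 0], Urysohn's lemma forces [sigma^k y = x].  Conversely, if
[x = sigma^m y], then translating sequences by [m] is an isometric
intertwiner. *)

Section homeo_exp_action.
Context {X : topologicalType} (sigma : homeo X).

(** The value [k = -1] is a case of its own, because there [k + 1] changes branch in [homeo_exp]. *)
Lemma homeo_expS (k : int) (z : X) :
  homeo_exp sigma (k + 1) z = sigma (homeo_exp sigma k z).
Proof.
case: k => [n|[|n]]; first by rewrite -PoszD addn1.
  by rewrite /= homeo_invK.
have -> : Negz n.+1 + 1 = Negz n by rewrite !NegzE -[n.+2]addn1 PoszD opprD subrK.
by rewrite [in RHS]/= homeo_invK.
Qed.

Lemma homeo_expB1 (k : int) (z : X) :
  homeo_exp sigma (k - 1) z = homeo_inv sigma (homeo_exp sigma k z).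
Proof. by rewrite -{2}(subrK 1 k) homeo_expS homeo_funK. Qed.

(** Induction on [m] away from 0 in both directions, by steps of [+ 1] and [- 1]. *)
Lemma homeo_expD (m k : int) (z : X) :
  homeo_exp sigma (m + k) z = homeo_exp sigma m (homeo_exp sigma k z).
Proof.
elim/int_rect: m => [|n IH|n IH]; first by rewrite add0r.
  by rewrite -addn1 PoszD addrAC !homeo_expS IH.
by rewrite -addn1 PoszD opprD addrAC !homeo_expB1 IH.
Qed.

Lemma eq_zorbit (m : int) (z : X) :
  zorbit sigma (homeo_exp sigma m z) = zorbit sigma z.
Proof.
apply/seteqP; split => _ [k _ <-].
  by exists (k + m); rewrite ?homeo_expD.
by exists (k - m); rewrite // -homeo_expD subrK.
Qed.

End homeo_exp_action.

Section lp_sequences.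
Context {R : realType} {p : \bar R} (p1 : (1 <= p)%E).

(** The sequence is the indicator of one point: its sup norm is at most 1, and its [r]-th power
    integrates to the counting measure of that point. *)
Lemma lpnorm_delta : (lpnorm p (fun k : int => ((k == 0)%:R)%R : R[i]) < +oo)%E.
Proof.
rewrite /lpnorm (_ : _ \o _ = EFin \o (\1_[set 0] : int -> R)); last first.
  apply/funext => k /=; rewrite indicE in_set1.
  by case: (k == 0); rewrite ?Normc.normc0 ?Normc.normc1.
rewrite unlock; case: (p) p1 => [r| |//] r1; last first.
  rewrite counting_gt0; apply: (@le_lt_trans _ _ 1%E); last exact: ltry.
  apply/ess_supP/nearW => k /=; rewrite lee_fin indicE.
  by case: (_ \in _); rewrite ?normr1 ?normr0.
have r0 : 0 < r by rewrite (lt_le_trans ltr01).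
apply: poweR_lty.
rewrite (eq_integral (EFin \o (\1_[set 0] : int -> R))); last first.
  move=> k _ /=; rewrite indicE; case: (_ \in _).
    by rewrite normr1 powR1.
  by rewrite normr0 powR0// gt_eqF.
by rewrite integral_indic// setIT [ltLHS]counting_set1 ltry.
Qed.

Definition lp_delta : lp p1 := Lp p1 lpnorm_delta.

Lemma lpnorm_shift (m : int) (xi : int -> R[i]) :
  lpnorm p (fun k => xi (k + m)) = lpnorm p xi.
Proof. exact: (Lnorm_counting_shift (fun k => normc (xi k)) m p1). Qed.

Lemma lp_shift_finite (m : int) (xi : lp p1) :
  (lpnorm p (fun k => xi (k + m)%R) < +oo)%E.
Proof. by rewrite lpnorm_shift lp_finite. Qed.

(** This is [S^(-m)] for the right shift [S]. *)
Definition lp_shift (m : int) (xi : lp p1) : lp p1 :=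
  Lp p1 (lp_shift_finite m xi).

Lemma lp_shift_linear m : linear (lp_shift m).
Proof. by move=> c xi zeta; apply/val_inj/funext. Qed.

HB.instance Definition _ m :=
  GRing.isLinear.Build R[i] (lp p1) (lp p1) _ (lp_shift m) (lp_shift_linear m).

Lemma lp_shiftK m : cancel (lp_shift m) (lp_shift (- m)).
Proof. by move=> xi; apply/val_inj/funext => k /=; rewrite subrK. Qed.

Lemma lp_shift_norm m (xi : lp p1) : `|lp_shift m xi| = `|xi|.
Proof.
have nE (z : lp p1) : `|z| = lp_norm z by [].
by rewrite !nE /lp_norm lpnorm_shift.
Qed.

End lp_sequences.

Section coefficient_functions.
Context {R : realType} {X : topologicalType}.
Implicit Type f : X -> R.

Lemma continuous_real_complex f : continuous f ->
  continuous ((fun z => (f z)%:C%C) : X -> R[i]^o).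
Proof.
move=> cf z; apply/cvgrPdist_lt => e e0.
(* A positive element of [R[i]] is real, so [e] serves as a radius in [R]. *)
have eE : e = (complex.Re e)%:C%C by rewrite RRe_real// gtr0_real.
have re0 : 0 < complex.Re e by rewrite -ltcR -eE.
move/cvgrPdist_lt : (cf z) => /(_ _ re0); apply: filterS => w.
by rewrite eE -rmorphB/= normr_normc ltcR /normc/= expr0n/= addr0 sqrtr_sqr.
Qed.

Section const_coef.
Variable f : X -> R.

(** The coefficients of [f delta^0], the copy of [f] in [l^1(Sigma)]. *)
Definition const_coef (n : int) : X -> R[i] :=
  if n == 0 then fun z => (f z)%:C%C else fun=> 0.

Lemma const_coef_continuous (cf : continuous f) n :
  continuous (const_coef n : X -> R[i]^o).
Proof.
rewrite /const_coef; case: ifP => _; first exact: continuous_real_complex.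
exact: cst_continuous.
Qed.

Lemma const_coef_summable (x0 : X) (f01 : forall z, 0 <= f z <= 1) :
  (\esum_(n in [set: int]) supnorm (const_coef n) < +oo)%E.
Proof.
(* The point [x0] excludes the empty space, where [supnorm] is [-oo]. *)
have sup_ge0 n : (0 <= supnorm (const_coef n))%E.
  apply: (@le_trans _ _ (normc (const_coef n x0))%:E).
    by rewrite lee_fin normc_ge0.
  by apply: ereal_sup_ubound; exists x0.
have E n : supnorm (const_coef n) =
    if n \in [set 0%R] then supnorm (const_coef n) else 0%E.
  rewrite in_set1; case: ifPn => // /negbTE n0.
  apply/eqP; rewrite eq_le sup_ge0 andbT; apply: ge_ereal_sup => _ [z _ <-].
  by rewrite /const_coef n0 Normc.normc0.
under eq_esum do rewrite E.
rewrite -esum_mkcond esum_set1//; apply: (@le_lt_trans _ _ 1%E); last exact: ltry.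
apply: ge_ereal_sup => _ [z _ <-]; rewrite /const_coef eqxx lee_fin.
have /andP[f0 f1] := f01 z.
by rewrite /normc/= expr0n/= addr0 sqrtr_sqr ger0_norm.
Qed.

End const_coef.

(** Urysohn's lemma for two singletons: a compact Hausdorff space is normal and its points are
    closed. The bounds on [f] feed [const_coef_summable]. *)
Lemma compact_separates_points {a b : X} : compact [set: X] ->
  hausdorff_space X -> a <> b ->
  exists f : X -> R, [/\ continuous f, forall z, 0 <= f z <= 1, f a = 0 & f b = 1].
Proof.
move=> cX hX ab; have aX := hausdorff_accessible hX.
have ab0 : [set a] `&` [set b] = set0.
  by apply/seteqP; split => // z [/= -> /ab].
have [f [cf fa fb f01]] := urysohn_ext_itv (compact_normal hX cX)
  (@accessible_closed_set1 _ aX a) (@accessible_closed_set1 _ aX b) ab0 (@ltr01 R).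
exists f; split => //.
- by move=> z; have := f01 (f z); rewrite /= in_itv/=; apply; exists z.
- by apply: fa; exists a.
- by apply: fb; exists b.
Qed.

End coefficient_functions.

Section equivalences.
Context {K : numFieldType} {A : Type} {V W : normedModType K}.
Variables (rho : A -> {linear V -> V}) (tau : A -> {linear W -> W}).

(** Distances replace norms so that the lemma also applies to an inverse that is only a bare
    function. *)
Lemma isometric_continuous (U U' : normedModType K) (T : U -> U') :
  (forall u v, `|T u - T v| = `|u - v|) -> continuous T.
Proof.
move=> iT u; apply/cvgrPdist_lt => e e0; near=> v.
rewrite iT; near: v; exact: (@cvgr_dist_lt _ _ _ _ _ id u cvg_id).
Unshelve. all: by end_near. Qed.

(** Surjectivity and choice give a right inverse; it is two-sided since a norm-preserving linear map
    is injective. *)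
Lemma isometrically_topologically_equivalent :
  isometrically_equivalent rho tau -> topologically_equivalent rho tau.
Proof.
move=> [T [iT /choice[T' T'K] Tint]]; exists T, T'.
have TK : cancel T T'.
  move=> v; apply/eqP; rewrite -subr_eq0 -normr_eq0 -iT linearB/= T'K.
  by rewrite subrr normr0.
split=> //; apply: isometric_continuous => u v; first by rewrite -linearB iT.
by rewrite -iT linearB/= !T'K.
Qed.

Lemma topologically_algebraically_equivalent :
  topologically_equivalent rho tau -> algebraically_equivalent rho tau.
Proof. by move=> [T [T' [TK T'K _ _ Ti]]]; exists T => //; exists T'. Qed.

End equivalences.

Section pi_rep_equivalence.
Context {R : realType} {X : topologicalType} (sigma : homeo X).
Context {p : \bar R} (p1 : (1 <= p)%E).

Lemma algebraically_equivalent_zorbit (x y : X) :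
  compact [set: X] -> hausdorff_space X ->
  algebraically_equivalent (pi_rep sigma x p1) (pi_rep sigma y p1) ->
  zorbit sigma x = zorbit sigma y.
Proof.
move=> cX hX [T /bij_inj Tinj Tint].
(* Otherwise [T] would kill [e_0], whose coordinate at 0 is 1. *)
have [k Tk0] : exists k, T (lp_delta p1) k != 0.
  apply: contrapT => /forallNP T0.
  have /(congr1 (fun xi : lp p1 => xi 0)) : lp_delta p1 = 0.
    apply: Tinj; rewrite linear0; apply/val_inj/funext => k /=.
    by have /negP/negbNE/eqP := T0 k.
  by move=> /eqP; rewrite [X in X == _]/= oner_eq0.
have [<-|/(compact_separates_points (R := R) cX hX)] :=
  pselect (homeo_exp sigma k y = x); first by rewrite eq_zorbit.
move=> [f [cf f01 fy fx]].
pose a := L1Sigma (const_coef_continuous f cf) (const_coef_summable f x f01).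
have a0 (n : int) z : n != 0 -> a n z = 0.
  by move=> /negbTE n0; rewrite /= /const_coef n0.
(* The eigenvalue of [e_0] under [a] is [f x = 1]. *)
have ad : pi_rep sigma x p1 a (lp_delta p1) = lp_delta p1.
  apply/val_inj/funext => j /=; rewrite -[LHS]/(pi_rep sigma x p1 a (lp_delta p1) j).
  rewrite (pi_rep_monomial _ _ _ _ a0) subr0 /= /const_coef eqxx.
  by have [->|_] := eqVneq j 0; rewrite ?mulr0// mulr1/= fx.
(* At coordinate [k], intertwining reads [T e_0 k = f (sigma^k y) * T e_0 k], and the factor
   [f (sigma^k y)] is 0. *)
have := congr1 (fun xi : lp p1 => xi k) (Tint a (lp_delta p1)).
rewrite ad (pi_rep_monomial _ _ _ _ a0) /= /const_coef eqxx fy mul0r.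
by move/eqP; rewrite (negbTE Tk0).
Qed.

Lemma zorbit_isometrically_equivalent (x y : X) :
  zorbit sigma x = zorbit sigma y ->
  isometrically_equivalent (pi_rep sigma x p1) (pi_rep sigma y p1).
Proof.
(* As [y] lies in its own orbit, it lies in that of [x]: [sigma^m x = y]. *)
move=> xy; have [m _ mE] : zorbit sigma x y by rewrite xy; exists 0.
exists (lp_shift p1 m); split => [v|w|a v]; first exact: lp_shift_norm.
  by exists (lp_shift p1 (- m) w); have := lp_shiftK p1 (- m) w; rewrite opprK.
(* The series agree term by term, because [sigma^k y = sigma^(k + m) x]. *)
apply/val_inj/funext => k /=; apply: eq_zsum => n.
by rewrite -mE -homeo_expD addrAC.
Qed.

End pi_rep_equivalence.

Theorem proposition3p8 (R : realType) (X : topologicalType)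
    (X_nonempty : [set: X] !=set0) (X_compact : compact [set: X])
    (X_hausdorff : hausdorff_space X) (sigma : homeo X) (x y : X)
    (x_aper : Aper sigma x) (y_aper : Aper sigma y)
    (p : \bar R) (p1 : (1 <= p)%E) :
  [<-> algebraically_equivalent (pi_rep sigma x p1) (pi_rep sigma y p1);
       topologically_equivalent (pi_rep sigma x p1) (pi_rep sigma y p1);
       isometrically_equivalent (pi_rep sigma x p1) (pi_rep sigma y p1);
       zorbit sigma x = zorbit sigma y].
Proof.
have alg_orbit :=
  algebraically_equivalent_zorbit sigma p1 x y X_compact X_hausdorff.
have orbit_iso := zorbit_isometrically_equivalent sigma p1 x y.
have iso_top := @isometrically_topologically_equivalent _ _ _ _
  (pi_rep sigma x p1) (pi_rep sigma y p1).
have top_alg := @topologically_algebraically_equivalent _ _ _ _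
  (pi_rep sigma x p1) (pi_rep sigma y p1).
(* The four implications form the cycle algebraic, orbit, isometric, topological; each goal in the
   listed order composes three of them. *)
tfae.
- by move=> /alg_orbit/orbit_iso/iso_top.
- by move=> /top_alg/alg_orbit/orbit_iso.
- by move=> /iso_top/top_alg/alg_orbit.
- by move=> /orbit_iso/iso_top/top_alg.
Qed.
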